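(* Let $(V,\circ,[\cdot,\cdot])$ be a Gel'fand-Dorfman bialgebra over $\mathbb{C}$, and set $a\ast b=a\circ b+b\circ a$ for $a,b\in V$. If $(V,\circ)$ is a simple Novikov algebra and $V=V\ast V$, then the quadratic Lie conformal algebra $R=\mathbb{C}[\partial]V$ corresponding to $(V,\circ,[\cdot,\cdot])$ is simple.
   Context: All vector spaces are over $\mathbb{C}$. $V\ast V$ denotes the $\mathbb{C}$-linear span of all elements $a\ast b$ with $a,b\in V$. A Lie conformal algebra is a $\mathbb{C}[\partial]$-module $R$ with a $\mathbb{C}$-bilinear $\lambda$-bracket $[\cdot_\lambda\cdot]:R\times R\to R[\lambda]=R\otimes\mathbb{C}[\lambda]$ such that for all $a,b,c\in R$: $[\partial a_\lambda b]=-\lambda[a_\lambda b]$ and $[a_\lambda\partial b]=(\lambda+\partial)[a_\lambda b]$; $[a_\lambda b]=-[b_{-\lambda-\partial}a]$; $[a_\lambda[b_\mu c]]=[[a_\lambda b]_{\lambda+\mu}c]+[b_\mu[a_\lambda c]]$. For subspaces $A,B\subset R$, $[A,B]$ is the $\mathbb{C}$-linear span of all coefficients (in powers of $\lambda$) of $[a_\lambda b]$, $a\in A$, $b\in B$. An ideal of $R$ is a $\mathbb{C}[\partial]$-submodule $I\subset R$ with $[R,I]\subset I$. $R$ is abelian if $[R,R]=0$, and simple if it is not abelian and its only ideals are $0$ and $R$. A Novikov algebra is a vector space $V$ with a bilinear product $\circ$ satisfying $(a\circ b)\circ c-a\circ(b\circ c)=(b\circ a)\circ c-b\circ(a\circ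 c)$ and $(a\circ b)\circ c=(a\circ c)\circ b$. An ideal of $(V,\circ)$ is a subspace $I$ with $V\circ I\subset I$ and $I\circ V\subset I$. $(V,\circ)$ is simple if its only ideals are $0$ and $V$ and $a\circ b\neq 0$ for some $a,b\in V$. A Gel'fand-Dorfman bialgebra $(V,\circ,[\cdot,\cdot])$ is a vector space $V$ with a Lie bracket $[\cdot,\cdot]$ and a product $\circ$ such that $(V,\circ)$ is a Novikov algebra and $[a\circ b,c]-[a\circ c,b]+[a,b]\circ c-[a,c]\circ b-a\circ[b,c]=0$ for all $a,b,c\in V$. The quadratic Lie conformal algebra corresponding to $(V,\circ,[\cdot,\cdot])$ is the free $\mathbb{C}[\partial]$-module $R=\mathbb{C}[\partial]V=\mathbb{C}[\partial]\otimes V$ with the $\lambda$-bracket determined by $[a_\lambda b]=\partial(b\circ a)+[b,a]+\lambda(a\circ b+b\circ a)$ for $a,b\in V$. *)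

(* Defs.v *)
From HB Require Import structures.
From mathcomp Require Import all_boot all_order all_algebra finmap.
From mathcomp Require Import monalg ring.
From mathcomp Require Import all_classical reals complex.

Set Implicit Arguments.
Unset Strict Implicit.
Unset Printing Implicit Defensive.

Import GRing.Theory.
Local Open Scope classical_set_scope.
Local Open Scope ring_scope.

(* [polymod M] is M[X] = A[X] (x)_A M, realised as the finitely supported maps
   nat -> M; [p@_k] is the coefficient of X^k. It serves both for
   K[d]V, where d is the derivation usually written as a partial sign, and for
   L[lambda]. It is a module over {poly A}, so that M[X][Y] is a module over
   {poly {poly A}}, where X is ['X%:P] and Y is ['X]. *)
Definition polymod (A : comNzRingType) (M : lmodType A) := {malg M[nat]}.

Section PolyModDefs.
Context (A : comNzRingType) (M : lmodType A).

HB.instance Definition _ := GRing.Zmodule.on (polymod M).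

Definition pmconst (m : M) : polymod M := << m *g 0%N >>.

Definition pmscale (q : {poly A}) (p : polymod M) : polymod M :=
  \sum_(i < size q) \sum_(k <- msupp p) << q`_i *: p@_k *g (i + k)%N >>.

End PolyModDefs.

(* Substitution of q for X: the element sum_k q^k f(p_k) of N; the map f gives
   the meaning in N of the coefficients. *)
Definition pmsubst (A B : comNzRingType) (M : lmodType A) (N : lmodType B)
    (f : M -> N) (q : B) (p : polymod M) : N :=
  \sum_(k <- msupp p) q ^+ k *: f p@_k.

Section Sums.
Context (A : comNzRingType) (M : lmodType A) (N : zmodType).
Context (F : nat -> M -> N) (FD : forall k, {morph F k : x y / x + y}).

Let F0 k : F k 0 = 0.
Proof. by apply: (@addrI _ (F k 0)); rewrite -FD !addr0. Qed.

Lemma msum_wide (d : {fset nat}) (p : polymod M) : (msupp p `<=` d)%fset ->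
  \sum_(k <- msupp p) F k p@_k = \sum_(k <- d) F k p@_k.
Proof.
move=> sub; rewrite [LHS](big_fset_incl _ sub) // => k _ /mcoeff_outdom ->.
exact: F0.
Qed.

Lemma msumD (p r : polymod M) : \sum_(k <- msupp (p + r)) F k (p + r)@_k =
  \sum_(k <- msupp p) F k p@_k + \sum_(k <- msupp r) F k r@_k.
Proof.
rewrite !(@msum_wide (msupp p `|` msupp r)%fset) ?fsubsetUl ?fsubsetUr //.
  by rewrite -big_split; apply: eq_bigr => k _; rewrite mcoeffD FD.
exact: msuppD_le.
Qed.

Lemma msumU m j : \sum_(k <- msupp (<< m *g j >> : polymod M))
   F k (<< m *g j >>)@_k = F j m.
Proof.
by rewrite (msum_wide msuppU_le) big_seq_fset1 mcoeffUU.
Qed.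

End Sums.

Section PolyModLmod.
Context (A : comNzRingType) (M : lmodType A).
Implicit Types (q r : {poly A}) (p s : polymod M) (c : A) (m : M).

Lemma polymod_ind (P : polymod M -> Prop) :
  (forall p s, P p -> P s -> P (p + s)) -> (forall m k, P << m *g k >>) ->
  forall p, P p.
Proof.
move=> PD PU p; rewrite (monalgE p).
apply: (big_ind P) => //; by rewrite -(@monalgU0 _ M 0%N).
Qed.

Lemma poly_monind (P : {poly A} -> Prop) :
  (forall q r, P q -> P r -> P (q + r)) -> (forall c k, P (c *: 'X^k)) ->
  forall q, P q.
Proof.
move=> PD PU q; rewrite -[q]coefK poly_def.
apply: (big_ind P) => //; by rewrite -(scale0r 'X^0).
Qed.

Lemma pmscaleDr q : {morph @pmscale A M q : p s / p + s}.
Proof.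
move=> p s; rewrite /pmscale -big_split; apply: eq_bigr => i _.
by rewrite (@msumD _ _ _ (fun k m => << q`_i *: m *g (i + k)%N >>)) // => k m n;
   rewrite scalerDr monalgUD.
Qed.

Lemma pmscale_wide n q p : (size q <= n)%N -> pmscale q p =
  \sum_(i < n) \sum_(k <- msupp p) << q`_i *: p@_k *g (i + k)%N >>.
Proof.
move=> le; rewrite /pmscale.
rewrite (big_ord_widen n (fun i => \sum_(k <- msupp p)
   << q`_i *: p@_k *g (i + k)%N >>)) // big_mkcond.
apply: eq_bigr => i _; case: ltnP => // h.
by rewrite big1 // => k _; rewrite nth_default // scale0r monalgU0.
Qed.

Lemma pmscaleDl p : {morph (@pmscale A M)^~ p : q r / q + r}.
Proof.
move=> q r /=; set n := maxn (size q) (size r).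
rewrite !(@pmscale_wide n) ?leq_maxl ?leq_maxr ?size_polyD //.
rewrite -big_split; apply: eq_bigr => i _; rewrite -big_split.
by apply: eq_bigr => k _; rewrite coefD scalerDl monalgUD.
Qed.

Lemma pmscaleU c i m k :
  pmscale (c *: 'X^i) << m *g k >> = << c *: m *g (i + k)%N >>.
Proof.
have sz : (size (c *: 'X^i : {poly A}) <= i.+1)%N.
  by rewrite (leq_trans (size_scale_leq _ _)) // size_polyXn.
rewrite (pmscale_wide _ sz) big_ord_recr big1 => [|j _] /=.
  have FD l : {morph (fun x : M => << (c *: 'X^i)`_i *: x *g (i + l)%N >>) :
      x y / x + y} by move=> x y; rewrite scalerDr monalgUD.
  by rewrite (msumU FD) coefZ coefXn eqxx mulr1 add0r.
rewrite big1 // => l _.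
by rewrite coefZ coefXn (ltn_eqF (ltn_ord j)) mulr0 scale0r monalgU0.
Qed.

Lemma pmscaleA q r p : pmscale q (pmscale r p) = pmscale (q * r) p.
Proof.
elim/polymod_ind: p => [p s hp hs|m k]; first by rewrite !pmscaleDr hp hs.
elim/poly_monind: q => [q q' hq hq'|c i].
  by rewrite mulrDl !pmscaleDl hq hq'.
elim/poly_monind: r => [q q' hq hq'|c' i'].
  by rewrite mulrDr !pmscaleDl -hq -hq' pmscaleDr.
have -> : (c *: 'X^i) * (c' *: 'X^i') = (c * c') *: 'X^(i + i') :> {poly A}.
  by rewrite -scalerAl -scalerAr scalerA exprD.
by rewrite !pmscaleU scalerA addnA.
Qed.

Lemma pmscale1 : left_id 1 (@pmscale A M).
Proof.
elim/polymod_ind => [p s hp hs|m k]; first by rewrite pmscaleDr hp hs.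
by rewrite -(expr0 'X) -[_ ^+ _]scale1r pmscaleU scale1r.
Qed.

HB.instance Definition _ := GRing.Zmodule_isLmodule.Build {poly A} (polymod M)
  pmscaleA pmscale1 pmscaleDr pmscaleDl.

Lemma polymodZU c i m k :
  (c *: 'X^i : {poly A}) *: (<< m *g k >> : polymod M) =
  << c *: m *g (i + k)%N >>.
Proof. exact: pmscaleU. Qed.

Lemma polymodXU m k :
  ('X : {poly A}) *: (<< m *g k >> : polymod M) = << m *g k.+1 >>.
Proof. by rewrite -['X]scale1r -['X]expr1 polymodZU scale1r. Qed.

Lemma polymodCU c m k :
  (c%:P : {poly A}) *: (<< m *g k >> : polymod M) = << c *: m *g k >>.
Proof. by rewrite -[c%:P]mulr1 -(expr0 'X) mul_polyC polymodZU. Qed.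

Lemma pmconstD : {morph @pmconst A M : x y / x + y}.
Proof. exact: monalgUD. Qed.

Lemma pmconstZ c m : pmconst (c *: m) = (c%:P : {poly A}) *: pmconst m.
Proof. by rewrite /pmconst polymodCU. Qed.

(* M[X] is spanned, as an abelian group, by the X^k m *)
Lemma polymod_genind (P : polymod M -> Prop) :
  (forall p s, P p -> P s -> P (p + s)) ->
  (forall p, P p -> P (('X : {poly A}) *: p)) ->
  (forall m, P (pmconst m)) -> forall p, P p.
Proof.
move=> PD PX PC; apply: polymod_ind => // m; elim=> [|k hk]; first exact: PC.
by rewrite -polymodXU; apply: PX.
Qed.

End PolyModLmod.

Section Subst.
Context (A B : comNzRingType) (M : lmodType A) (N : lmodType B).
Implicit Types (f : M -> N) (q : B) (p : polymod M).

Lemma eq_pmsubst f g q p : f =1 g -> pmsubst f q p = pmsubst g q p.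
Proof. by move=> e; apply: eq_bigr => k _; rewrite e. Qed.

Lemma pmsubstZf f q p c : pmsubst (fun m => c *: f m) q p = c *: pmsubst f q p.
Proof.
rewrite /pmsubst scaler_sumr; apply: eq_bigr => k _.
by rewrite !scalerA mulrC.
Qed.

Lemma pmsubstDf f g q p :
  pmsubst (fun m => f m + g m) q p = pmsubst f q p + pmsubst g q p.
Proof. by rewrite /pmsubst -big_split; apply: eq_bigr => k _; rewrite scalerDr. Qed.

Section Additive.
Context (f : M -> N) (fD : {morph f : x y / x + y}) (q : B).

Let aux k : {morph (fun m => q ^+ k *: f m) : x y / x + y}.
Proof. by move=> x y; rewrite fD scalerDr. Qed.

Lemma pmsubstD : {morph pmsubst f q : p r / p + r}.
Proof. by move=> p r; rewrite /pmsubst (msumD aux). Qed.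

Lemma pmsubstU m k : pmsubst f q << m *g k >> = q ^+ k *: f m.
Proof. by rewrite /pmsubst (msumU aux). Qed.

Lemma pmsubst_const m : pmsubst f q (pmconst m) = f m.
Proof. by rewrite pmsubstU expr0 scale1r. Qed.

Lemma pmsubstX p : pmsubst f q (('X : {poly A}) *: p) = q *: pmsubst f q p.
Proof.
elim/polymod_ind: p => [p s hp hs|m k].
  by rewrite scalerDr !pmsubstD hp hs scalerDr.
by rewrite polymodXU !pmsubstU exprS scalerA.
Qed.

Lemma pmsubstC c d p : (forall m, f (c *: m) = d *: f m) ->
  pmsubst f q ((c%:P : {poly A}) *: p) = d *: pmsubst f q p.
Proof.
move=> h; elim/polymod_ind: p => [p s hp hs|m k].
  by rewrite scalerDr !pmsubstD hp hs scalerDr.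
by rewrite polymodCU !pmsubstU h !scalerA mulrC.
Qed.

Lemma pmsubst0 : pmsubst f q 0 = 0.
Proof. by apply: (@addrI _ (pmsubst f q 0)); rewrite -pmsubstD !addr0. Qed.

Lemma pmsubstN p : pmsubst f q (- p) = - pmsubst f q p.
Proof. by apply/eqP; rewrite -addr_eq0 -pmsubstD addNr pmsubst0. Qed.

End Additive.
End Subst.

(* The scaling [s] is a parameter because a K[d]-module has both K[d]-submodules
   and K-subspaces. *)

Section Subspaces.
Context (K : nzRingType) (M : zmodType) (s : K -> M -> M).

Definition is_subspace (W : set M) :=
  W 0 /\ forall c x y, W x -> W y -> W (s c x + y).

Definition linspan (S : set M) : set M := smallest is_subspace S.

End Subspaces.

Section LieConformal.
Context (K : fieldType).

Definition kscale (L : lmodType {poly K}) (c : K) (x : L) : L := c%:P *: x.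

(* In [polymod L] = L[lambda] the variable lambda is ['X] and d is ['X%:P]. *)
Definition conformal_sesquilinear (L : lmodType {poly K}) (br : L -> L -> polymod L) :=
  (forall a b, br ('X *: a) b = (- 'X : {poly {poly K}}) *: br a b) /\
  (forall a b, br a ('X *: b) = ('X + 'X%:P : {poly {poly K}}) *: br a b).

Definition conformal_bilinear (L : lmodType {poly K}) (br : L -> L -> polymod L) :=
  (forall c a a' b, br (kscale c a + a') b =
     (c%:P%:P : {poly {poly K}}) *: br a b + br a' b) /\
  (forall c a b b', br a (kscale c b + b') =
     (c%:P%:P : {poly {poly K}}) *: br a b + br a b').

(* [a_lambda b] = - [b_{- lambda - d} a] *)
Definition conformal_skew (L : lmodType {poly K}) (br : L -> L -> polymod L) :=
  forall a b, br a b =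
    - pmsubst (@pmconst _ L) (- 'X - 'X%:P : {poly {poly K}}) (br b a).

(* The Jacobi identity in L[lambda][mu]: lambda is ['X%:P] and mu is ['X];
   [at_ q a b] is [a_q b], and the outer bracket is applied to the coefficients
   of the inner one. *)
Definition conformal_jacobi (L : lmodType {poly K}) (br : L -> L -> polymod L) :=
  let lambda : {poly {poly {poly K}}} := 'X%:P in
  let mu : {poly {poly {poly K}}} := 'X in
  let at_ q a b : polymod (polymod L) :=
    pmsubst (fun x : L => pmconst (pmconst x)) q (br a b) in
  forall a b c,
    pmsubst (fun x => at_ lambda a x) mu (br b c) =
    pmsubst (fun x => at_ (lambda + mu) x c) lambda (br a b) +
    pmsubst (fun x => at_ mu b x) lambda (br a c).

Record lieConformalAlgebra := LieConformalAlgebra {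
  lca_module :> lmodType {poly K};
  lbracket : lca_module -> lca_module -> polymod lca_module;
  lbracket_bilinear : conformal_bilinear lbracket;
  lbracket_sesquilinear : conformal_sesquilinear lbracket;
  lbracket_skew : conformal_skew lbracket;
  lbracket_jacobi : conformal_jacobi lbracket
}.

Definition bracket_space (L : lieConformalAlgebra) (S T : set L) : set L :=
  linspan (@kscale L)
    [set x | exists a b n, [/\ S a, T b & x = (lbracket a b)@_n]].

Definition lca_ideal (L : lieConformalAlgebra) (I : set L) :=
  is_subspace *:%R I /\ bracket_space setT I `<=` I.

Definition lca_abelian (L : lieConformalAlgebra) :=
  bracket_space setT setT = [set 0 : L].

Definition lca_simple (L : lieConformalAlgebra) :=
  ~ lca_abelian L /\
  forall I : set L, lca_ideal I -> I = [set 0] \/ I = setT.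

End LieConformal.

Section GelfandDorfman.
Context (K : fieldType) (V : lmodType K).

Definition bilinear_op (op : V -> V -> V) :=
  (forall a, linear (op a)) /\ (forall b, linear (op^~ b)).

Record is_lie (lie : V -> V -> V) : Prop := IsLie {
  lie_bilinear : bilinear_op lie;
  lie_alt : forall a, lie a a = 0;
  lie_jacobi : forall a b c,
    lie a (lie b c) + lie b (lie c a) + lie c (lie a b) = 0
}.

Record is_novikov (op : V -> V -> V) : Prop := IsNovikov {
  novikov_bilinear : bilinear_op op;
  novikov_lsym : forall a b c,
    op (op a b) c - op a (op b c) = op (op b a) c - op b (op a c);
  novikov_rcomm : forall a b c, op (op a b) c = op (op a c) b
}.

Record is_gelfand_dorfman (op lie : V -> V -> V) : Prop := IsGelfandDorfman {
  gd_lie : is_lie lie;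
  gd_novikov : is_novikov op;
  gd_compat : forall a b c,
    lie (op a b) c - lie (op a c) b + op (lie a b) c - op (lie a c) b
      - op a (lie b c) = 0
}.

Definition novikov_ideal (op : V -> V -> V) (I : set V) :=
  is_subspace *:%R I /\ forall a x, I x -> I (op a x) /\ I (op x a).

Definition novikov_simple (op : V -> V -> V) :=
  (forall I, novikov_ideal op I -> I = [set 0] \/ I = setT) /\
  exists a b, op a b != 0.

Definition star (op : V -> V -> V) (a b : V) := op a b + op b a.

Definition star_span (op : V -> V -> V) : set V :=
  linspan *:%R [set x | exists a b, x = star op a b].

(* The lambda-bracket on K[d]V: on a, b in V it is
   d(b o a) + [b, a] + lambda (a * b), extended by
   [f(d)a_lambda g(d)b] = f(-lambda) g(lambda + d) [a_lambda b]. *)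
Definition quadratic_gen (op lie : V -> V -> V) (a b : V) :
    polymod (polymod V) :=
  let iota (v : V) : polymod (polymod V) := pmconst (pmconst v) in
  ('X%:P : {poly {poly K}}) *: iota (op b a) + iota (lie b a)
    + ('X : {poly {poly K}}) *: iota (star op a b).

Definition quadratic_bracket (op lie : V -> V -> V) (u v : polymod V) :
    polymod (polymod V) :=
  pmsubst (fun a => pmsubst (quadratic_gen op lie a)
                      ('X + 'X%:P : {poly {poly K}}) v)
          (- 'X : {poly {poly K}}) u.

End GelfandDorfman.

(* [module_ring B] proves identities between B-linear combinations of atoms of a
   B-module, by [ring] on the coefficient of each atom. *)
Section ModuleNormalisation.
Context (B : comNzRingType) (N : lmodType B).

Inductive mexpr :=
  | MAtom of nat | MAdd of mexpr & mexpr | MOpp of mexpr | MScale of B & mexpr.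

Fixpoint meval (e : seq N) (t : mexpr) : N :=
  match t with
  | MAtom i => e`_i
  | MAdd t u => meval e t + meval e u
  | MOpp t => - meval e t
  | MScale c t => c *: meval e t
  end.

Fixpoint mcoef (t : mexpr) (j : nat) : B :=
  match t with
  | MAtom i => if i == j then 1 else 0
  | MAdd t u => mcoef t j + mcoef u j
  | MOpp t => - mcoef t j
  | MScale c t => c * mcoef t j
  end.

Lemma mevalE e t : meval e t = \sum_(j < size e) mcoef t j *: e`_j.
Proof.
elim: t => [i|t ht u hu|t ht|c t ht] /=.
- case: (ltnP i (size e)) => h.
    rewrite (bigD1 (Ordinal h)) //= eqxx scale1r big1 ?addr0 // => j.
    by rewrite -val_eqE /= eq_sym => /negbTE ->; rewrite scale0r.
  rewrite nth_default // big1 // => j _.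
  by rewrite (gtn_eqF (leq_trans (ltn_ord j) h)) scale0r.
- by rewrite ht hu -big_split; apply: eq_bigr => j _; rewrite scalerDl.
- by rewrite ht -sumrN; apply: eq_bigr => j _; rewrite scaleNr.
- by rewrite ht scaler_sumr; apply: eq_bigr => j _; rewrite scalerA.
Qed.

Fixpoint mcoefs_eq (n : nat) (t u : mexpr) : Prop :=
  match n with
  | 0 => True
  | n.+1 => mcoef t n = mcoef u n /\ mcoefs_eq n t u
  end.

Lemma meval_eq e t u : mcoefs_eq (size e) t u -> meval e t = meval e u.
Proof.
move=> h; rewrite !mevalE; apply: eq_bigr => j _; congr (_ *: _).
move: h (ltn_ord j); move: (nat_of_ord j) => i; elim: (size e) => //= n ih [h1 h2].
by rewrite ltnS leq_eqVlt => /orP[/eqP -> //|]; apply: ih.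
Qed.

End ModuleNormalisation.

Ltac mod_find x e :=
  lazymatch e with
  | x :: _ => constr:(0%N)
  | _ :: ?e' => let n := mod_find x e' in constr:(S n)
  end.
Ltac mod_mem x e :=
  lazymatch e with
  | x :: _ => constr:(true)
  | _ :: ?e' => mod_mem x e'
  | _ => constr:(false)
  end.
Ltac mod_atoms t e :=
  lazymatch t with
  | GRing.add ?a ?b => let e := mod_atoms a e in mod_atoms b e
  | GRing.opp ?a => mod_atoms a e
  | GRing.scale _ ?a => mod_atoms a e
  | _ => lazymatch mod_mem t e with
         | true => e
         | false => constr:(t :: e)
         end
  end.
Ltac mod_quote B t e :=
  lazymatch t with
  | GRing.add ?a ?b =>
    let a := mod_quote B a e in let b := mod_quote B b e in
    constr:(@MAdd B a b)
  | GRing.opp ?a => let a := mod_quote B a e in constr:(@MOpp B a)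
  | GRing.scale ?c ?a => let a := mod_quote B a e in constr:(@MScale B c a)
  | _ => let n := mod_find t e in constr:(@MAtom B n)
  end.
Ltac module_ring B :=
  lazymatch goal with
  | |- @eq ?T ?x ?y =>
    let e := mod_atoms x constr:(@nil T) in
    let e := mod_atoms y e in
    let t := mod_quote B x e in
    let u := mod_quote B y e in
    apply: (@meval_eq B _ e t u); cbn [size mcoefs_eq mcoef eqn eq_op];
    rewrite /= ; repeat split; ring
  end.

Section Quadratic.
Context (K : fieldType) (V : lmodType K) (op lie : V -> V -> V).
Hypothesis gd : is_gelfand_dorfman op lie.

Let opDl b : {morph op^~ b : x y / x + y}.
Proof.
have [[_ h] _ _] := gd_novikov gd.
by move=> x y /=; rewrite -[x]scale1r (h b 1 x y) !scale1r.
Qed.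

Let opDr a : {morph op a : x y / x + y}.
Proof.
have [[h _] _ _] := gd_novikov gd.
by move=> x y /=; rewrite -[x]scale1r (h a 1 x y) !scale1r.
Qed.

Let lieDl b : {morph lie^~ b : x y / x + y}.
Proof.
have [[_ h] _ _] := gd_lie gd.
by move=> x y /=; rewrite -[x]scale1r (h b 1 x y) !scale1r.
Qed.

Let lieDr a : {morph lie a : x y / x + y}.
Proof.
have [[h _] _ _] := gd_lie gd.
by move=> x y /=; rewrite -[x]scale1r (h a 1 x y) !scale1r.
Qed.

Let opZl b c x : op (c *: x) b = c *: op x b.
Proof.
have [[_ h] _ _] := gd_novikov gd.
have h0 : op 0 b = 0 by apply: (@addrI _ (op 0 b)); rewrite -opDl !addr0.
by have := h b c x 0; rewrite /= h0 !addr0.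
Qed.

Let opZr b c x : op b (c *: x) = c *: op b x.
Proof.
have [[h _] _ _] := gd_novikov gd.
have h0 : op b 0 = 0 by apply: (@addrI _ (op b 0)); rewrite -opDr !addr0.
by have := h b c x 0; rewrite /= h0 !addr0.
Qed.

Let lieZl b c x : lie (c *: x) b = c *: lie x b.
Proof.
have [[_ h] _ _] := gd_lie gd.
have h0 : lie 0 b = 0 by apply: (@addrI _ (lie 0 b)); rewrite -lieDl !addr0.
by have := h b c x 0; rewrite /= h0 !addr0.
Qed.

Let lieZr b c x : lie b (c *: x) = c *: lie b x.
Proof.
have [[h _] _ _] := gd_lie gd.
have h0 : lie b 0 = 0 by apply: (@addrI _ (lie b 0)); rewrite -lieDr !addr0.
by have := h b c x 0; rewrite /= h0 !addr0.
Qed.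

Let lieC a b : lie a b = - lie b a.
Proof.
have [_ alt _] := gd_lie gd.
by have := alt (a + b); rewrite lieDr !lieDl !alt add0r addr0 => /eqP;
   rewrite addr_eq0 => /eqP ->; rewrite opprK.
Qed.

Local Notation gen := (quadratic_gen op lie).
Local Notation qbr := (quadratic_bracket op lie).
Local Notation d := ('X : {poly K}).
Local Notation d1 := ('X%:P : {poly {poly K}}).
Local Notation la1 := ('X : {poly {poly K}}).

Let genDr a : {morph gen a : x y / x + y}.
Proof.
move=> x y; rewrite /quadratic_gen /star opDl opDr lieDl !pmconstD.
by module_ring {poly {poly K}}.
Qed.

Let genDl b : {morph gen^~ b : x y / x + y}.
Proof.
move=> x y; rewrite /quadratic_gen /star opDl opDr lieDr !pmconstD.
by module_ring {poly {poly K}}.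
Qed.

Let genZr a (c : K) b : gen a (c *: b) = (c%:P%:P : {poly {poly K}}) *: gen a b.
Proof.
rewrite /quadratic_gen /star opZl opZr lieZl -scalerDr !pmconstZ !pmconstD.
by module_ring {poly {poly K}}.
Qed.

Let genZl a (c : K) b : gen (c *: a) b = (c%:P%:P : {poly {poly K}}) *: gen a b.
Proof.
rewrite /quadratic_gen /star opZl opZr lieZr -scalerDr !pmconstZ !pmconstD.
by module_ring {poly {poly K}}.
Qed.

Let innerD v : {morph (fun a => pmsubst (gen a) (la1 + d1) v) : x y / x + y}.
Proof.
by move=> x y /=; rewrite -pmsubstDf; apply: eq_pmsubst => b; rewrite genDl.
Qed.

Let qbrDl v : {morph qbr^~ v : x y / x + y}.
Proof. by move=> x y; rewrite /quadratic_bracket /= (pmsubstD (innerD v)). Qed.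

Let qbrDr u : {morph qbr u : x y / x + y}.
Proof.
move=> x y; rewrite /quadratic_bracket -pmsubstDf; apply: eq_pmsubst => a.
exact: (pmsubstD (genDr a)).
Qed.

Let qbrXl u v : qbr (d *: u) v = - la1 *: qbr u v.
Proof. by rewrite /quadratic_bracket (pmsubstX (innerD v)). Qed.

Let qbrXr u v : qbr u (d *: v) = (la1 + d1) *: qbr u v.
Proof.
rewrite /quadratic_bracket -pmsubstZf; apply: eq_pmsubst => a.
exact: (pmsubstX (genDr a)).
Qed.

Let qbrCl (c : K) u v : qbr (c%:P *: u) v = (c%:P%:P : {poly {poly K}}) *: qbr u v.
Proof.
rewrite /quadratic_bracket (@pmsubstC _ _ _ _ _ (innerD v) _ _ c%:P%:P) // => a.
by rewrite -pmsubstZf; apply: eq_pmsubst => b.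
Qed.

Let qbrCr (c : K) u v : qbr u (c%:P *: v) = (c%:P%:P : {poly {poly K}}) *: qbr u v.
Proof.
rewrite /quadratic_bracket -pmsubstZf; apply: eq_pmsubst => a.
exact: (pmsubstC (genDr a)).
Qed.

Lemma quadratic_bracket_const a b :
  quadratic_bracket op lie (pmconst a) (pmconst b) = quadratic_gen op lie a b.
Proof.
by rewrite /quadratic_bracket (pmsubst_const (innerD _)) (pmsubst_const (genDr _)).
Qed.

Lemma quadratic_bilinear : conformal_bilinear qbr.
Proof.
split=> c a a' b; rewrite /kscale.
  by rewrite qbrDl qbrCl.
by rewrite qbrDr qbrCr.
Qed.

Lemma quadratic_sesquilinear : conformal_sesquilinear qbr.
Proof. by split=> a b; [exact: qbrXl | exact: qbrXr]. Qed.

(* Evaluation of [u_q v] in a module where d acts on the image of [f] as [D] *)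
Section At.
Context (B : comNzRingType) (N : lmodType B) (f : polymod V -> N) (D : B).
Hypothesis fD : {morph f : x y / x + y}.
Hypothesis fX : forall x, f (d *: x) = D *: f x.
Variable q : B.

Definition quadratic_at u v := pmsubst f q (qbr u v).
Local Notation bra := quadratic_at.

Lemma braDl v : {morph bra^~ v : x y / x + y}.
Proof. by move=> x y; rewrite /bra /= qbrDl (pmsubstD fD). Qed.

Lemma braDr u : {morph bra u : x y / x + y}.
Proof. by move=> x y; rewrite /bra /= qbrDr (pmsubstD fD). Qed.

Lemma braXl u v : bra (d *: u) v = - q *: bra u v.
Proof.
by rewrite /bra qbrXl scaleNr (pmsubstN fD) (pmsubstX fD) scaleNr.
Qed.

Lemma braXr u v : bra u (d *: v) = (q + D) *: bra u v.
Proof.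
rewrite /bra qbrXr !scalerDl (pmsubstD fD) (pmsubstX fD).
by rewrite (@pmsubstC _ _ _ _ _ fD _ _ D).
Qed.

Lemma bra_const (g : V -> N) : (forall x, f (pmconst x) = g x) -> forall a b,
  bra (pmconst a) (pmconst b) =
  D *: g (op b a) + g (lie b a) + q *: (g (op a b) + g (op b a)).
Proof.
move=> e a b; rewrite -!e /bra quadratic_bracket_const /quadratic_gen !(pmsubstD fD).
rewrite (pmsubstX fD) (pmsubstC fD q (pmconst (pmconst (op b a))) fX).
by rewrite !(pmsubst_const fD) /star pmconstD fD.
Qed.

End At.

Lemma quadratic_skew : conformal_skew qbr.
Proof.
have cD : {morph (fun x : polymod V => pmconst x) : x y / x + y} by exact: pmconstD.
have cX (x : polymod V) : pmconst (d *: x) = d1 *: pmconst x.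
  exact: pmconstZ.
move=> u v.
change (qbr u v =
  - quadratic_at (fun x : polymod V => pmconst x) (- la1 - d1) v u).
elim/polymod_genind: u v => [u u' hu hu' v|u hu v|a v].
- by rewrite qbrDl hu hu' (braDr cD) opprD.
- by rewrite qbrXl hu (braXr cD cX) addrNK scalerN.
elim/polymod_genind: v => [v v' hv hv'|v hv|b].
- by rewrite qbrDr hv hv' (braDl cD) opprD.
- rewrite qbrXr hv (braXl cD).
  by module_ring {poly {poly K}}.
rewrite (bra_const cD cX _ (g := fun x => pmconst (pmconst x)) (fun=> erefl)) quadratic_bracket_const /quadratic_gen /star.
rewrite [lie b a]lieC !pmconstD.
have -> : forall x : V, pmconst (pmconst (- x)) =
   - pmconst (pmconst x) :> polymod (polymod V).
  by move=> x; apply/eqP; rewrite -addr_eq0 -!pmconstD addNr /pmconst !monalgU0.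
by module_ring {poly {poly K}}.
Qed.

Section Jacobi.
Context (B : comNzRingType) (N : lmodType B) (i : polymod V -> N) (D la mu : B).
Hypothesis iD : {morph i : x y / x + y}.
Hypothesis iX : forall x, i (d *: x) = D *: i x.

Let atD (f g h : polymod V -> N) q x y : (forall z, h z = f z + g z) ->
  quadratic_at h q x y = quadratic_at f q x y + quadratic_at g q x y.
Proof.
by move=> e; rewrite /quadratic_at -pmsubstDf; apply: eq_pmsubst.
Qed.

Let atZ (c : B) (f h : polymod V -> N) q x y : (forall z, h z = c *: f z) ->
  quadratic_at h q x y = c *: quadratic_at f q x y.
Proof.
by move=> e; rewrite /quadratic_at -pmsubstZf; apply: eq_pmsubst.
Qed.

Local Notation bra q := (quadratic_at i q).

Let D1 q x : {morph bra q x : y z / y + z}.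
Proof. exact: braDr. Qed.
Let X1 q x y : bra q x (d *: y) = (q + D) *: bra q x y.
Proof. exact: braXr. Qed.
Let D2 q x : {morph (bra q)^~ x : y z / y + z}.
Proof. exact: braDl. Qed.
Let X2 q x y : bra q (d *: y) x = - q *: bra q y x.
Proof. exact: braXl. Qed.

Let T1 u v w := quadratic_at (bra la u) mu v w.
Let T2 u v w := quadratic_at (fun x => bra (la + mu) x w) la u v.
Let T3 u v w := quadratic_at (bra mu v) la u w.

Let jacobi_const a b c :
  T1 (pmconst a) (pmconst b) (pmconst c) =
  T2 (pmconst a) (pmconst b) (pmconst c) + T3 (pmconst a) (pmconst b) (pmconst c).
Proof.
pose j x := i (pmconst x).
have jD x y : j (x + y) = j x + j y by rewrite /j pmconstD iD.
have j0 : j 0 = 0 by apply: (@addrI _ (j 0)); rewrite -jD !addr0.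
have jN x : j (- x) = - j x by apply/eqP; rewrite -addr_eq0 -jD addNr j0.
pose g q x y := D *: j (op y x) + j (lie y x) + q *: (j (op x y) + j (op y x)).
have e q x y : bra q (pmconst x) (pmconst y) = g q x y.
  exact: (bra_const iD iX q (fun=> erefl)).
have -> : T1 (pmconst a) (pmconst b) (pmconst c) =
    (la + D) *: g la a (op c b) + g la a (lie c b)
    + mu *: (g la a (op b c) + g la a (op c b)).
  exact: (bra_const (D1 la (pmconst a)) (X1 la (pmconst a)) mu (e la a)).
have -> : T2 (pmconst a) (pmconst b) (pmconst c) =
    - (la + mu) *: g (la + mu) (op b a) c + g (la + mu) (lie b a) c
    + la *: (g (la + mu) (op a b) c + g (la + mu) (op b a) c).
  exact: (bra_const (D2 (la + mu) (pmconst c)) (X2 (la + mu) (pmconst c)) la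
    (fun x => e (la + mu) x c)).
have -> : T3 (pmconst a) (pmconst b) (pmconst c) =
    (mu + D) *: g mu b (op c a) + g mu b (lie c a)
    + la *: (g mu b (op a c) + g mu b (op c a)).
  exact: (bra_const (D1 mu (pmconst b)) (X1 mu (pmconst b)) la (e mu b)).
rewrite /g.
clear e g T1 T2 T3 D1 D2 X1 X2.
clearbody j.
have oNl x y : op (- x) y = - op x y by rewrite -scaleN1r opZl scaleN1r.
have oNr x y : op x (- y) = - op x y by rewrite -scaleN1r opZr scaleN1r.
have lNl x y : lie (- x) y = - lie x y by rewrite -scaleN1r lieZl scaleN1r.
have lNr x y : lie x (- y) = - lie x y by rewrite -scaleN1r lieZr scaleN1r.
have [_ lsym rcomm] := gd_novikov gd.
have [_ _ lieJ] := gd_lie gd.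
have compat := gd_compat gd.
rewrite [op (op c b) a]rcomm [op (op b c) a]rcomm [op (op a c) b]rcomm.
rewrite [lie c b]lieC [lie b a]lieC [lie c a]lieC.
rewrite [lie c (op b a)]lieC [lie c (op a b)]lieC.
rewrite ?(oNl, oNr, lNl, lNr) ?(jN, opprK).
have lsymJ x y z : j (op (op x y) z) - j (op x (op y z)) =
    j (op (op y x) z) - j (op y (op x z)) by rewrite -!jN -!jD lsym.
have compatJ x y z : j (lie (op x y) z) - j (lie (op x z) y) + j (op (lie x y) z)
    - j (op (lie x z) y) - j (op x (lie y z)) = 0.
  by rewrite -!jN -!jD compat j0.
have e1 : j (op a (op b c)) =
    j (op (op a b) c) - j (op (op b a) c) + j (op b (op a c)).
  rewrite -[LHS]addr0 -(subrr (j (op (op a b) c) - j (op a (op b c)))).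
  rewrite {2}lsymJ; by module_ring B.
have e2 : j (op a (op c b)) =
    j (op (op a b) c) - j (op (op c a) b) + j (op c (op a b)).
  rewrite -[LHS]addr0 -(subrr (j (op (op a c) b) - j (op a (op c b)))).
  rewrite {2}lsymJ [op (op a c) b]rcomm; by module_ring B.
have e3 : j (op b (op c a)) =
    j (op (op b a) c) - j (op (op c a) b) + j (op c (op b a)).
  rewrite -[LHS]addr0 -(subrr (j (op (op b c) a) - j (op b (op c a)))).
  rewrite {2}lsymJ [op (op b c) a]rcomm [op (op c b) a]rcomm; by module_ring B.
have e4 : j (lie (op b a) c) = j (lie (op b c) a) + j (op (lie a b) c)
    + j (op (lie b c) a) + j (op b (lie a c)).
  rewrite -[RHS]addr0 -(compatJ b a c) [lie b a]lieC oNl jN; by module_ring B.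
have e5 : j (lie (op a b) c) = j (lie (op a c) b) - j (op (lie a b) c)
    + j (op (lie a c) b) + j (op a (lie b c)).
  rewrite -[RHS]addr0 -(compatJ a b c); by module_ring B.
have e6 : j (lie (op c b) a) = j (lie (op c a) b) + j (op (lie b c) a)
    - j (op (lie a c) b) - j (op c (lie a b)).
  rewrite -[RHS]addr0 -(compatJ c b a) [lie c b]lieC [lie c a]lieC [lie b a]lieC.
  rewrite !(oNl, oNr, jN); by module_ring B.
have e7 : j (lie (lie b c) a) = j (lie (lie a c) b) + j (lie c (lie a b)).
  rewrite [lie (lie b c) a]lieC [lie (lie a c) b]lieC [lie a c]lieC lNr opprK.
  rewrite -[LHS]addr0 -j0 -(lieJ a b c) !(jD, jN); by module_ring B.
rewrite e1 e2 e3 e4 e5 e6 e7.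
by module_ring B.
Qed.

Lemma quadratic_jacobi_at u0 v0 w0 : T1 u0 v0 w0 = T2 u0 v0 w0 + T3 u0 v0 w0.
Proof.
have T1D1 u u' v w : T1 (u + u') v w = T1 u v w + T1 u' v w.
  by apply: atD => z; exact: D2.
have T2D1 u u' v w : T2 (u + u') v w = T2 u v w + T2 u' v w.
  exact: (braDl (D2 (la + mu) w) la v u u').
have T3D1 u u' v w : T3 (u + u') v w = T3 u v w + T3 u' v w.
  exact: (braDl (D1 mu v) la w u u').
have T1D2 u v v' w : T1 u (v + v') w = T1 u v w + T1 u v' w.
  exact: (braDl (D1 la u) mu w v v').
have T2D2 u v v' w : T2 u (v + v') w = T2 u v w + T2 u v' w.
  exact: (braDr (D2 (la + mu) w) la u v v').
have T3D2 u v v' w : T3 u (v + v') w = T3 u v w + T3 u v' w.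
  by apply: atD => z; exact: D2.
have T1D3 u v w w' : T1 u v (w + w') = T1 u v w + T1 u v w'.
  exact: (braDr (D1 la u) mu v w w').
have T2D3 u v w w' : T2 u v (w + w') = T2 u v w + T2 u v w'.
  by apply: atD => z; exact: D1.
have T3D3 u v w w' : T3 u v (w + w') = T3 u v w + T3 u v w'.
  exact: (braDr (D1 mu v) la u w w').
have T1X1 u v w : T1 (d *: u) v w = - la *: T1 u v w.
  by apply: atZ => z; exact: X2.
have T2X1 u v w : T2 (d *: u) v w = - la *: T2 u v w.
  exact: (braXl (D2 (la + mu) w) la u v).
have T3X1 u v w : T3 (d *: u) v w = - la *: T3 u v w.
  exact: (braXl (D1 mu v) la u w).
have T1X2 u v w : T1 u (d *: v) w = - mu *: T1 u v w.
  exact: (braXl (D1 la u) mu v w).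
have T2X2 u v w : T2 u (d *: v) w = - mu *: T2 u v w.
  rewrite /T2 (braXr (D2 (la + mu) w) (X2 (la + mu) w) la u v).
  by congr (_ *: _); ring.
have T3X2 u v w : T3 u (d *: v) w = - mu *: T3 u v w.
  by apply: atZ => z; exact: X2.
have T1X3 u v w : T1 u v (d *: w) = (la + mu + D) *: T1 u v w.
  rewrite /T1 (braXr (D1 la u) (X1 la u) mu v w).
  by congr (_ *: _); ring.
have T2X3 u v w : T2 u v (d *: w) = (la + mu + D) *: T2 u v w.
  by apply: atZ => z; exact: X1.
have T3X3 u v w : T3 u v (d *: w) = (la + mu + D) *: T3 u v w.
  rewrite /T3 (braXr (D1 mu v) (X1 mu v) la u w).
  by congr (_ *: _); ring.
have jc := jacobi_const.
clearbody T1 T2 T3.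
elim/polymod_genind: u0 v0 w0 => [u u' hu hu' v w|u hu v w|a v w].
- by rewrite T1D1 T2D1 T3D1 hu hu' addrACA.
- by rewrite T1X1 T2X1 T3X1 hu scalerDr.
elim/polymod_genind: v w => [v v' hv hv' w|v hv w|b w].
- by rewrite T1D2 T2D2 T3D2 hv hv' addrACA.
- by rewrite T1X2 T2X2 T3X2 hv scalerDr.
elim/polymod_genind: w => [w w' hw hw'|w hw|c].
- by rewrite T1D3 T2D3 T3D3 hw hw' addrACA.
- by rewrite T1X3 T2X3 T3X3 hw scalerDr.
exact: jc.
Qed.
End Jacobi.

Lemma quadratic_jacobi : conformal_jacobi qbr.
Proof.
pose i (x : polymod V) : polymod (polymod (polymod V)) := pmconst (pmconst x).
have iD : {morph i : x y / x + y} by move=> x y; rewrite /i !pmconstD.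
have iX (x : polymod V) : i (d *: x) = ('X%:P%:P : {poly {poly {poly K}}}) *: i x.
  by rewrite /i !pmconstZ.
move=> u v w.
exact: (quadratic_jacobi_at 'X%:P 'X iD iX u v w).
Qed.

Definition quadratic_lca : lieConformalAlgebra K :=
  LieConformalAlgebra quadratic_bilinear quadratic_sesquilinear
    quadratic_skew quadratic_jacobi.

End Quadratic.

(* Main.v *)
Require Import Defs.
From mathcomp Require Import all_boot all_order all_algebra.
From mathcomp Require Import all_classical reals complex.
From mathcomp Require Import monalg.

(* Let Z be the set of v with v * V = 0; the Novikov identities make it an
   ideal, so V * V <> 0 forces Z = 0. Let I be a nonzero ideal of R. For
   u = d^n v_n + lower terms in I with v_n <> 0, the coefficient of lambda^(n+1)
   in [a_lambda u] is a * v_n, so I meets V nontrivially. Let J be the set of v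
   such that d v + w lies in I for some w in V; it contains the intersection of
   I and V. The coefficients of lambda^2 and lambda in [a_lambda (d v + w)] show
   that V * J lies in I and that J is an ideal of V. Hence J = V, and
   V = V * V = V * J lies in I. *)

Section Simplicity.

Set Implicit Arguments.
Unset Strict Implicit.
Unset Printing Implicit Defensive.

Import GRing.Theory.
Local Open Scope classical_set_scope.
Local Open Scope ring_scope.

(** * Coefficients and degree in M[X] *)

Section Coefficients.
Context (A : comNzRingType) (M : lmodType A).
Implicit Types (p : polymod M) (c : A) (m : M).

Lemma mcoeff_pmconst m k : (pmconst m)@_k = if k == 0%N then m else 0.
Proof. by rewrite /pmconst mcoeffU eq_sym; case: eqP. Qed.

Lemma mcoeff_pmX p k :
  (('X : {poly A}) *: p)@_k = if k is k'.+1 then p@_k' else 0.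
Proof.
elim/polymod_ind: p k => [p s hp hs|m j] k.
  by rewrite scalerDr mcoeffD hp hs; case: k => *; rewrite ?addr0 ?mcoeffD.
by rewrite polymodXU mcoeffU; case: k => [|k] //; rewrite mcoeffU eqSS.
Qed.

Lemma mcoeff_pmC c p k : ((c%:P : {poly A}) *: p)@_k = c *: p@_k.
Proof.
elim/polymod_ind: p k => [p s hp hs|m j] k.
  by rewrite scalerDr !mcoeffD hp hs scalerDr.
by rewrite polymodCU !mcoeffU; case: eqP; rewrite ?scaler0.
Qed.

Lemma mcoeff_pmXD c p k :
  (('X + c%:P : {poly A}) *: p)@_k.+1 = p@_k + c *: p@_k.+1.
Proof. by rewrite scalerDl mcoeffD mcoeff_pmX mcoeff_pmC. Qed.

(** Division by X with remainder; it drives the induction on the degree in d in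
    [mcoeff_quadratic_lead]. *)
Lemma polymod_tail p :
  exists p' : polymod M, p = ('X : {poly A}) *: p' + pmconst p@_0%N.
Proof.
elim/polymod_genind: p => [p s [p' hp] [s' hs]|p _|m].
- exists (p' + s'); rewrite mcoeffD pmconstD scalerDr addrACA.
  by rewrite {1}hp {1}hs.
- by exists p; rewrite mcoeff_pmX /pmconst monalgU0 addr0.
- by exists 0; rewrite scaler0 add0r mcoeff_pmconst eqxx.
Qed.

Lemma pmconst0 : pmconst (0 : M) = 0.
Proof. exact: monalgU0. Qed.

Lemma polymod_bounded p : exists n, forall k, (n < k)%N -> p@_k = 0.
Proof.
elim/polymod_ind: p => [p s [m hp] [n hs]|m j].
  by exists (maxn m n) => k; rewrite gtn_max mcoeffD => /andP[/hp -> /hs ->];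
     rewrite addr0.
by exists j => k jk; rewrite mcoeffU (ltn_eqF jk).
Qed.

Lemma polymod_lead p : p != 0 ->
  exists n, p@_n != 0 /\ forall k, (n < k)%N -> p@_k = 0.
Proof.
move=> p0; have [N] := polymod_bounded p.
elim: N => [|N ih] h.
  exists 0%N; split=> //; apply: contra p0 => /eqP p00; apply/eqP/malgP.
  by case=> [|k]; rewrite mcoeff0 // h.
have [pN|pN] := eqVneq (p@_N.+1) 0; last by exists N.+1.
apply: ih => k; rewrite leq_eqVlt => /orP[/eqP <- //|]; exact: h.
Qed.

End Coefficients.

(** * The annihilator of the symmetrized Novikov product *)

Section Novikov.
Context (K : fieldType) (V : lmodType K) (op : V -> V -> V).
Hypothesis nov : is_novikov op.

Lemma novDl a b c : op (a + b) c = op a c + op b c.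
Proof.
have [[_ h] _ _] := nov.
by rewrite -[a]scale1r (h c 1 a b) !scale1r.
Qed.

Lemma novDr a b c : op a (b + c) = op a b + op a c.
Proof.
have [[h _] _ _] := nov.
by rewrite -[b]scale1r (h a 1 b c) !scale1r.
Qed.

Lemma nov0l a : op 0 a = 0.
Proof. by apply: (@addrI _ (op 0 a)); rewrite -novDl !addr0. Qed.

Lemma nov0r a : op a 0 = 0.
Proof. by apply: (@addrI _ (op a 0)); rewrite -novDr !addr0. Qed.

Lemma novZl k a b : op (k *: a) b = k *: op a b.
Proof.
have [[_ h] _ _] := nov.
by have := h b k a 0; rewrite /= nov0l !addr0.
Qed.

Lemma novZr k a b : op a (k *: b) = k *: op a b.
Proof.
have [[h _] _ _] := nov.
by have := h a k b 0; rewrite /= nov0r !addr0.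
Qed.

Lemma novNl a b : op (- a) b = - op a b.
Proof. by rewrite -scaleN1r novZl scaleN1r. Qed.

Lemma novNr a b : op a (- b) = - op a b.
Proof. by rewrite -scaleN1r novZr scaleN1r. Qed.

(** If v is annihilated, then b o v = - v o b for all b. With right commutativity this gives (v o b)
    o a = v o (b o a), so one side of left symmetry vanishes and b o (v o a) = (b o v) o a = - (v o
    a) o b. Hence v o a is annihilated, and so is a o v = - v o a. *)
Lemma star_annihilator_ideal :
  novikov_ideal op [set v | forall a, star op a v = 0].
Proof.
have [_ lsym rcomm] := nov.
split.
  split=> [a|c x y hx hy a]; first by rewrite /star nov0l nov0r addr0.
  rewrite /star !novDl !novDr novZl novZr addrACA -scalerDr.
  by rewrite [op a x + _](hx a) [op a y + _](hy a) scaler0 addr0.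
move=> a v hv.
have anti b : op b v = - op v b by apply/eqP; rewrite -addr_eq0; apply/eqP/hv.
suff annih b : star op b (op v a) = 0.
  split=> // b; rewrite anti /star novNl novNr -opprD.
  by apply/eqP; rewrite oppr_eq0; apply/eqP/annih.
have e : op (op v b) a = op v (op b a).
  by rewrite -[op v b]opprK -anti novNl rcomm anti opprK.
have := lsym v b a; rewrite e subrr => /esym/eqP; rewrite subr_eq0 /star => /eqP <-.
by rewrite anti novNl [op (op v a) b]rcomm addNr.
Qed.

Lemma star_nondegenerate : novikov_simple op -> star_span op = setT ->
  forall v, (forall a, star op a v = 0) -> v = 0.
Proof.
move=> [simp [x [y xy]]] span v hv.
case: (simp _ star_annihilator_ideal) => Z; first by have : [set 0] v by rewrite -Z.
have star0 a b : star op a b = 0.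
  by have : [set: V] b by []; rewrite -Z; apply.
(* The annihilator is all of V here, so V = V * V would be zero, against x o y <> 0. *)
suff /seteqP[V0 _] : [set: V] = [set 0].
  by case/eqP: xy; exact: V0.
apply/seteqP; split=> // u _.
have : star_span op u by rewrite span.
apply: smallest_sub => [|w [a [b ->]]]; last exact: star0.
by split=> // c a b -> ->; rewrite scaler0 addr0.
Qed.

End Novikov.

(** * Coefficients of the quadratic bracket in powers of lambda *)

Section QuadraticBracket.
Context (K : fieldType) (V : lmodType K) (op lie : V -> V -> V).
Hypothesis gd : is_gelfand_dorfman op lie.

Local Notation L := (quadratic_lca gd).
Local Notation br := (quadratic_bracket op lie).
Local Notation d := ('X : {poly K}).
Local Notation d1 := ('X%:P : {poly {poly K}}).
Local Notation la1 := ('X : {poly {poly K}}).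

Lemma quadratic_bracketDr u v w : br u (v + w) = br u v + br u w.
Proof.
have [_ h] := quadratic_bilinear gd.
by have := h 1 u v w; rewrite /kscale !scale1r.
Qed.

Lemma quadratic_bracketXr u v : br u (d *: v) = (la1 + d1) *: br u v.
Proof. exact: (quadratic_sesquilinear gd).2. Qed.

Lemma mcoeff_quadratic_const a b k : (br (pmconst a) (pmconst b))@_k =
  match k with
  | 0 => d *: pmconst (op b a) + pmconst (lie b a)
  | 1 => pmconst (star op a b)
  | _ => 0
  end.
Proof.
rewrite (quadratic_bracket_const gd) /quadratic_gen !mcoeffD mcoeff_pmC.
rewrite mcoeff_pmX !mcoeff_pmconst.
by case: k => [|[|k]]; rewrite /= ?mcoeff_pmconst ?scaler0 ?addr0 ?add0r.
Qed.

(** Write u = d u' + u_0. By sesquilinearity u' contributes (lambda + d) [a_lambda u']: lambda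
    shifts its leading coefficient up by one, and d only meets a coefficient that vanishes by the
    second conjunct. The bracket with u_0 has degree at most 1 in lambda, so it matters only for n =
    0. *)
Lemma mcoeff_quadratic_lead a n (u : polymod V) :
  (forall k, (n < k)%N -> u@_k = 0) ->
  (br (pmconst a) u)@_n.+1 = pmconst (star op a u@_n) /\
  forall k, (n.+1 < k)%N -> (br (pmconst a) u)@_k = 0.
Proof.
elim: n u => [|n ih] u hu; have [u' eu] := polymod_tail u.
  have -> : u = pmconst u@_0%N.
    apply/malgP => k; rewrite mcoeff_pmconst; case: k => // k; exact: hu.
  split=> [|[|[|k]] //]; rewrite !mcoeff_quadratic_const //.
  by rewrite mcoeff_pmconst.
have u'E k : u'@_k = u@_k.+1.
  by rewrite [in RHS]eu mcoeffD mcoeff_pmX mcoeff_pmconst addr0.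
have /ih [lead top] k : (n < k)%N -> u'@_k = 0 by rewrite u'E => ?; exact: hu.
have -> : br (pmconst a) u = (la1 + d1) *: br (pmconst a) u'
    + br (pmconst a) (pmconst u@_0%N).
  by rewrite {1}eu quadratic_bracketDr quadratic_bracketXr.
have c0 k : (br (pmconst a) (pmconst u@_0%N))@_k.+2 = 0.
  exact: mcoeff_quadratic_const.
rewrite -u'E; move: (br _ u') (br _ (pmconst _)) lead top c0 => p q lead top c0.
split=> [|[|[|k]] // nk]; rewrite mcoeffD mcoeff_pmXD c0.
  by rewrite lead top // scaler0 !addr0.
by rewrite !top ?scaler0 ?addr0 // ltnW.
Qed.

Lemma mcoeff_quadratic_linear a v w k :
  (br (pmconst a) (d *: pmconst v + pmconst w))@_k.+1 =
  (br (pmconst a) (pmconst v))@_k + d *: (br (pmconst a) (pmconst v))@_k.+1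
    + (br (pmconst a) (pmconst w))@_k.+1.
Proof.
rewrite quadratic_bracketDr quadratic_bracketXr.
by move: (br _ _) (br _ _) => p q; rewrite mcoeffD mcoeff_pmXD.
Qed.

Lemma mcoeff_quadratic_linear1 a v w :
  (br (pmconst a) (d *: pmconst v + pmconst w))@_1%N =
  d *: pmconst (op v a + star op a v) + pmconst (lie v a + star op a w).
Proof.
rewrite mcoeff_quadratic_linear.
have v0 := mcoeff_quadratic_const a v 0%N.
have v1 := mcoeff_quadratic_const a v 1%N.
have w1 := mcoeff_quadratic_const a w 1%N.
(* Generalizing the brackets stops unification from unfolding them when [v] is
   compared with [w]. *)
move: (br _ _) (br _ _) v0 v1 w1 => p q -> -> ->.
by rewrite (pmconstD (op v a)) (pmconstD (lie v a)) scalerDr addrACA addrA.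
Qed.

Lemma mcoeff_quadratic_linear2 a v w :
  (br (pmconst a) (d *: pmconst v + pmconst w))@_2%N = pmconst (star op a v).
Proof.
rewrite mcoeff_quadratic_linear.
have v1 := mcoeff_quadratic_const a v 1%N.
have v2 := mcoeff_quadratic_const a v 2%N.
have w2 := mcoeff_quadratic_const a w 2%N.
move: (br _ _) (br _ _) v1 v2 w2 => p q -> -> ->.
by rewrite scaler0 !addr0.
Qed.

Lemma quadratic_not_abelian : (exists a b, star op a b != 0) -> ~ lca_abelian L.
Proof.
move=> [a [b /eqP ab]] ab0; apply: ab.
have : bracket_space (setT : set L) setT (pmconst (star op a b)).
  apply: sub_gen_smallest; exists (pmconst a), (pmconst b), 1%N; split=> //.
  by rewrite mcoeff_quadratic_const.
rewrite ab0 => /(congr1 (fun p : polymod V => p@_0%N)).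
by rewrite mcoeff_pmconst mcoeff0.
Qed.

(** * Ideals of R and the ideals of V that they induce *)

Section Ideal.
Context (I : set L).
Hypothesis idI : lca_ideal I.

Lemma lca_ideal0 : I 0. Proof. by case: idI => -[]. Qed.

Lemma lca_idealZD q x y : I x -> I y -> I (q *: x + y).
Proof. by case: idI => -[_ h] _; exact: h. Qed.

Lemma lca_idealD x y : I x -> I y -> I (x + y).
Proof. by rewrite -{2}[x]scale1r; exact: lca_idealZD. Qed.

Lemma lca_idealZ q x : I x -> I (q *: x).
Proof. by rewrite -[q *: x]addr0 => /lca_idealZD; apply; exact: lca_ideal0. Qed.

Lemma lca_ideal_mcoeff (u v : polymod V) k : I v -> I (br u v)@_k.
Proof.
case: idI => _ sub hv; apply: sub; apply: sub_gen_smallest.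
by exists u, v, k.
Qed.

Lemma lca_ideal_setT : (forall v : V, I (pmconst v)) -> I = setT.
Proof.
move=> h; apply/seteqP; split=> // u _.
elim/(@polymod_genind K V): u => // [u v|u]; first exact: lca_idealD.
exact: lca_idealZ.
Qed.

(** For v in the intersection of I and V, the constant coefficient of [a_lambda v] puts d (v o a) +
    [v, a] in I, but not v o a itself. Allowing the correction w absorbs the Lie bracket. *)
Definition linear_coefs : set V :=
  [set v | exists w, I (d *: pmconst v + pmconst w)].

Lemma star_linear_coefs a v : linear_coefs v -> I (pmconst (star op a v)).
Proof.
move=> [w hw]; have := lca_ideal_mcoeff (pmconst a) 2%N hw.
by rewrite mcoeff_quadratic_linear2.
Qed.

Lemma linear_coefs_subspace : is_subspace *:%R linear_coefs.
Proof.
split=> [|c x y [w hw] [w' hw']].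
  by exists 0; rewrite !pmconst0 scaler0 addr0; exact: lca_ideal0.
exists (c *: w + w'); rewrite !pmconstD !pmconstZ.
have -> : d *: (c%:P *: pmconst x + pmconst y) + (c%:P *: pmconst w + pmconst w') =
    c%:P *: (d *: pmconst x + pmconst w) + (d *: pmconst y + pmconst w').
  by rewrite scalerDr scalerA mulrC -scalerA addrACA -scalerDr.
exact: lca_idealZD.
Qed.

Lemma const_linear_coefs v : I (pmconst v) -> linear_coefs v.
Proof. by move=> h; exists 0; rewrite pmconst0 addr0; exact: lca_idealZ. Qed.

Lemma linear_coefsB x y : linear_coefs x -> linear_coefs y -> linear_coefs (x - y).
Proof.
have [_ h] := linear_coefs_subspace.
by move=> hx hy; rewrite addrC -scaleN1r; exact: h.
Qed.

(** The coefficient of lambda is again linear in d, with d-part v o a + a * v. As a * v already lies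
    in I, subtracting it leaves v o a, and then a o v = a * v - v o a. *)
Lemma linear_coefs_ideal : novikov_ideal op linear_coefs.
Proof.
split=> [|a v hv]; first exact: linear_coefs_subspace.
have Jstar : linear_coefs (star op a v).
  exact/const_linear_coefs/star_linear_coefs.
have Jva : linear_coefs (op v a).
  have -> : op v a = op v a + star op a v - star op a v by rewrite addrK.
  apply: linear_coefsB Jstar; have [w hw] := hv.
  exists (lie v a + star op a w); have := lca_ideal_mcoeff (pmconst a) 1%N hw.
  by rewrite mcoeff_quadratic_linear1.
split; last exact: Jva.
have -> : op a v = star op a v - op v a by rewrite addrK.
exact: linear_coefsB Jstar Jva.
Qed.

Lemma lca_ideal_trivial : novikov_simple op -> star_span op = setT ->
  I = [set 0] \/ I = setT.
Proof.
move=> simp span.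
have [sub|/existsNP[u /not_implyP[Iu /eqP u0]]] := pselect (forall u, I u -> u = 0).
  left; apply/seteqP; split=> [u /sub //|u ->]; exact: lca_ideal0.
right.
have [n [un top]] := polymod_lead u0.
(* The leading coefficient is nonzero, so it is not in the annihilator. *)
have [a ha] : exists a, star op a u@_n != 0.
  apply: contrapT => h; case/eqP: un.
  apply: (star_nondegenerate (gd_novikov gd) simp span) => a.
  by apply: contrapT => /eqP ha; apply: h; exists a.
have Jstar : linear_coefs (star op a u@_n).
  apply: const_linear_coefs; rewrite -(mcoeff_quadratic_lead a top).1.
  exact: lca_ideal_mcoeff.
have [J0|JT] := simp.1 _ linear_coefs_ideal.
  by move: Jstar; rewrite J0 => /eqP; rewrite (negbTE ha).
(* Now every product b * c lies in I, and these products span V, which generates R over K[d]. *)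
apply: lca_ideal_setT => v.
have : star_span op v by rewrite span.
apply: (@smallest_sub _ _ _ [set v | I (pmconst v)]) => [|_ [b [c ->]]].
  split=> [|c x y hx hy]; first by rewrite /= pmconst0; exact: lca_ideal0.
  by rewrite /= pmconstD pmconstZ; exact: lca_idealZD.
by apply: star_linear_coefs; rewrite JT.
Qed.

End Ideal.
End QuadraticBracket.
End Simplicity.

Theorem theorem3p5 (R : realType) (V : lmodType R[i]%C) (op lie : V -> V -> V)
    (gd : is_gelfand_dorfman op lie) :
  novikov_simple op ->
  star_span op = [set: V]%classic ->
  lca_simple (quadratic_lca gd).
Proof.
move=> simp span; split=> [|I idI]; last exact: lca_ideal_trivial.
apply: quadratic_not_abelian; have [x [y xy]] := simp.2.
apply: contrapT => h.
(* If all a * b vanished, every vector would be annihilated, hence zero. *)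
have star0 a b : star op a b = 0%R.
  by apply: contrapT => /eqP ab; apply: h; exists a, b.
have V0 (v : V) : v = 0%R.
  exact: (star_nondegenerate (gd_novikov gd) simp span (star0^~ v)).
by case/eqP: xy; rewrite [LHS]V0.
Qed.
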